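(* The radial Laplacian $L$ on the rotation groups is given by the following expressions. (i) Case of $\mathrm{SO}_{2p}\mathbb{R}$, for $p\ge 2$: $$L=\sum_{j=1}^p\frac{\partial^2}{\partial\theta_j^2}+\sum_{1\le j<k\le p}\frac{2}{\cos\theta_k-\cos\theta_j}\Big(\sin\theta_j\,\frac{\partial}{\partial\theta_j}-\sin\theta_k\,\frac{\partial}{\partial\theta_k}\Big).$$ (ii) Case of $\mathrm{SO}_{2p+1}\mathbb{R}$, for $p\ge 1$: $$L=\sum_{j=1}^p\Big(\frac{\partial^2}{\partial\theta_j^2}+\frac{\sin\theta_j}{1-\cos\theta_j}\,\frac{\partial}{\partial\theta_j}\Big)+\sum_{1\le j<k\le p}\frac{2}{\cos\theta_k-\cos\theta_j}\Big(\sin\theta_j\,\frac{\partial}{\partial\theta_j}-\sin\theta_k\,\frac{\partial}{\partial\theta_k}\Big),$$ where for $p=1$ the second sum is empty. That is, for every $\varphi\in C^\infty(\mathcal{T})$, $L\varphi$ is given by applying the displayed operator to $\varphi$, at every $\Theta=(\theta_1,\dots,\theta_p)$ at which the denominators do not vanish.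
   Context: $\mathrm{SO}_n\mathbb{R}$ is the group of real $n\times n$ matrices $A$ with $AA^T=A^TA=\mathrm{I}$, $\det A=1$; its Lie algebra $\mathfrak{so}_n\mathbb{R}$ is the space of antisymmetric matrices. Matrices carry the inner product $A\cdot B=\frac12\mathrm{Tr}(A^TB)$, and $\mathrm{SO}_n\mathbb{R}$ carries the Riemannian metric $(AP,AQ)=P\cdot Q$ for $P,Q\in\mathfrak{so}_n\mathbb{R}$. $\Delta$ denotes the corresponding Laplacian; equivalently, with $F_{ij}=e_i\otimes e_j-e_j\otimes e_i$ (an orthonormal basis of $\mathfrak{so}_n\mathbb{R}$ for $i<j$), $(\Delta f)(A)=\sum_{1\le i<j\le n}\frac{d^2}{dt^2}f(Ae^{tF_{ij}})|_{t=0}$ for $f \in C^\infty(\mathrm{SO}_n\mathbb{R})$. $\Delta$ commutes with left and right translations, so it maps class functions (functions with $f(gAg^{-1})=f(A)$ for all $A,g$) to class functions. Let $n=2p$ ($p\ge2$) or $n=2p+1$ ($p\ge1$). Let $R_\theta=\begin{pmatrix}\cos\theta&-\sin\theta\\ \sin\theta&\cos\theta\end{pmatrix}$. For $\Theta=(\theta_1,\dots,\theta_p)\in\mathbb{R}^p$, $A_\Theta\in\mathrm{SO}_n\mathbb{R}$ is the block-diagonal matrix with diagonal blocks $R_{\theta_1},\dots,R_{\theta_p}$ if $n=2p$, and $R_{\theta_1},\dots,R_{\theta_p},1$ if $n=2p+1$. Every element of $\mathrm{SO}_n\mathbb{R}$ is conjugate to some $A_\Theta$. The Weyl group $\mathfrak{W}$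 acts on $(\mathbb{R}/2\pi\mathbb{Z})^p$ by permutations of the coordinates combined with sign changes of coordinates: an even number of sign changes if $n=2p$, an arbitrary number if $n=2p+1$. Set $\mathcal{T}=(\mathbb{R}/2\pi\mathbb{Z})^p/\mathfrak{W}$; $C^\infty(\mathcal{T})$ denotes the smooth $\mathfrak{W}$-invariant functions on $(\mathbb{R}/2\pi\mathbb{Z})^p$. For a smooth class function $f$, $\varphi_f(\Theta)=f(A_\Theta)$ belongs to $C^\infty(\mathcal{T})$, and every $\varphi\in C^\infty(\mathcal{T})$ equals $\varphi_f$ for a unique smooth class function $f$. The radial Laplacian is the linear operator $L:C^\infty(\mathcal{T})\to C^\infty(\mathcal{T})$ defined by $L\varphi_f=\varphi_{\Delta f}$ for every smooth class function $f$. *)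

(* Defs.v *)
From mathcomp Require Import all_boot all_order all_algebra all_fingroup.
From mathcomp Require Import all_classical all_reals all_analysis.

Set Implicit Arguments.
Unset Strict Implicit.
Unset Printing Implicit Defensive.

Import Order.TTheory GRing.Theory Num.Theory.
Import numFieldNormedType.Exports.

Local Open Scope classical_set_scope.
Local Open Scope ring_scope.

(* [Ck_on k U f]: f is C^k on U.  Intended for U open and V finite-dimensional,
   where C^{k+1} means differentiable with all directional derivatives C^k. *)
Fixpoint Ck_on (R : realType) (V : normedModType R) (k : nat)
    (U : set V) (f : V -> R) : Prop :=
  if k is k'.+1 then
    (forall x, U x -> differentiable f x) /\
    (forall v, Ck_on k' U (fun x => 'D_v f x))
  else forall x, U x -> {for x, continuous f}.

Definition smooth_on (R : realType) (V : normedModType R)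
    (U : set V) (f : V -> R) : Prop := forall k, Ck_on k U f.

Definition SO (R : realType) (n : nat) : set 'M[R]_n :=
  [set A | [/\ A *m A^T = 1%:M, A^T *m A = 1%:M & \det A = 1]].

(* Functions on SO_n are represented by functions on all matrices; their values
   outside SO_n play no role anywhere below.  Smoothness on the submanifold SO_n
   is the existence of local smooth extensions to open sets of matrices. *)
Definition smooth_on_SO (R : realType) (n : nat) (f : 'M[R]_n -> R) : Prop :=
  forall A, SO A -> exists U : set 'M[R]_n, exists g : 'M[R]_n -> R,
    [/\ open U, U A, smooth_on U g & forall B, U B -> SO B -> f B = g B].

Definition class_function (R : realType) (n : nat) (f : 'M[R]_n -> R) : Prop :=
  forall A g, SO A -> SO g -> f (g *m A *m invmx g) = f A.

Definition expm (R : realType) (n : nat) (X : 'M[R]_n) : 'M[R]_n :=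
  limn (series (fun k : nat => (k`!%:R : R)^-1 *: X ^+ k)).

Definition so_basis (R : realType) (n : nat) (i j : 'I_n) : 'M[R]_n :=
  delta_mx i j - delta_mx j i.

Definition laplacian (R : realType) (n : nat) (f : 'M[R]_n -> R)
    (A : 'M[R]_n) : R :=
  \sum_(i < n) \sum_(j < n | (i < j)%N)
    derive1n 2 (fun t : R => f (A *m expm (t *: so_basis R i j))) 0.

(* Entry of the plane rotation R_theta; [false] is the first row/column. *)
Definition rot2 (R : realType) (theta : R) (a b : bool) : R :=
  if a == b then cos theta else if b then - sin theta else sin theta.

(* A_Theta, for n = 2p or n = 2p+1: with 0-based indices, the k-th diagonal block
   occupies the rows and columns 2k and 2k+1, and the last summand contributes the
   final diagonal entry 1 at index 2p, which exists only when n = 2p+1. *)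
Definition torus_mx (R : realType) (n p : nat) (Theta : 'rV[R]_p) : 'M[R]_n :=
  \matrix_(i < n, j < n)
    (\sum_(k < p | (i./2 == k :> nat) && (j./2 == k :> nat))
        rot2 (Theta 0 k) (odd i) (odd j)
     + ((i == j) && (i == p.*2 :> nat))%:R).

Definition restr_torus (R : realType) (n p : nat) (f : 'M[R]_n -> R)
    (Theta : 'rV[R]_p) : R := f (torus_mx n Theta).

(* The Weyl group element (s, e): permutation s, sign changes at the j with e j. *)
Definition weyl_act (R : realType) (p : nat) (s : 'S_p) (e : {ffun 'I_p -> bool})
    (Theta : 'rV[R]_p) : 'rV[R]_p :=
  \row_j ((-1) ^+ e j * Theta 0 (s j)).

Definition weyl_mem (n p : nat) (e : {ffun 'I_p -> bool}) : bool :=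
  odd n || ~~ odd #|[pred j | e j]|.

(* C^oo(T): functions on (R/2piZ)^p are the functions on R^p that are
   2pi-periodic in each coordinate. *)
Definition smooth_torus (R : realType) (n p : nat) (phi : 'rV[R]_p -> R) : Prop :=
  [/\ smooth_on setT phi,
      forall (j : 'I_p) Theta, phi (Theta + (2 * pi) *: delta_mx 0 j) = phi Theta
    & forall s e Theta, weyl_mem n e -> phi (weyl_act s e Theta) = phi Theta].

(* The graph { (phi_f, phi_{Delta f}) : f a smooth class function } of the radial
   Laplacian L, i.e. psi = L phi. *)
Definition radial_laplacian (R : realType) (n p : nat)
    (phi psi : 'rV[R]_p -> R) : Prop :=
  exists f : 'M[R]_n -> R,
    [/\ smooth_on_SO f, class_function f,
        phi = restr_torus f & psi = restr_torus (laplacian f)].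

Definition pd (R : realType) (p : nat) (j : 'I_p) (phi : 'rV[R]_p -> R) :
    'rV[R]_p -> R := fun Theta => 'D_(delta_mx 0 j) phi Theta.

Definition pair_term (R : realType) (p : nat) (phi : 'rV[R]_p -> R)
    (Theta : 'rV[R]_p) : R :=
  \sum_(j < p) \sum_(k < p | (j < k)%N)
    2 / (cos (Theta 0 k) - cos (Theta 0 j)) *
      (sin (Theta 0 j) * pd j phi Theta - sin (Theta 0 k) * pd k phi Theta).

Definition even_operator (R : realType) (p : nat) (phi : 'rV[R]_p -> R)
    (Theta : 'rV[R]_p) : R :=
  \sum_(j < p) pd j (pd j phi) Theta + pair_term phi Theta.

Definition odd_operator (R : realType) (p : nat) (phi : 'rV[R]_p -> R)
    (Theta : 'rV[R]_p) : R :=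
  \sum_(j < p) (pd j (pd j phi) Theta
      + sin (Theta 0 j) / (1 - cos (Theta 0 j)) * pd j phi Theta)
  + pair_term phi Theta.

(* Main.v *)
Require Import Defs.
From mathcomp Require Import all_boot all_order all_algebra all_fingroup.
From mathcomp Require Import all_classical all_reals all_analysis.
From mathcomp Require Import ring lra zify.

(** Fix a smooth class function [f], a torus element [A] and [X] in so_n.  The
    second derivative of [f (A e^(tX))] at [t = 0] is computed separately for
    each basis vector [X = F_ij].

    If [i] and [j] lie in the same 2x2 block [k], the curve [A e^(tX)] stays in
    the torus and the second derivative is [d^2 phi / d theta_k^2]
    ([laplacian_same_block]).

    If [i] and [j] lie in different blocks, [X] is transverse to the torus, and
    at a regular [A] it is tangent to the conjugacy class: there is [Z] in so_n
    with [A Z - Z A = A X] ([rotator_eq]).  Let [g] be a local smooth extension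
    of [f].  Class invariance gives [Dg(B)[B Z - Z B] = 0] for all [B] in SO_n
    near [A] ([diff_class_functionC]).  Along [B(t) = A e^(tX)] the first
    derivative of [f] is therefore
    [Dg(B(t))[B(t) X - (B(t) Z - Z B(t))]].  The bracketed direction vanishes at
    [t = 0], so the second derivative at [0] only differentiates that
    direction, and equals [Dg(A)[A (Z X - X Z)]]
    ([second_derivative_class_function]): no second derivative of [g] is left.

    For [X = F_ij] the commutator [Z X - X Z] is again in the Cartan
    subalgebra, a combination of the two rotation generators of the blocks of
    [i] and [j] ([rotator_comm]), so the second derivative is a combination of
    the two corresponding partial derivatives of [phi]
    ([laplacian_cross_block]).  Each pair of planar blocks contributes four
    equal terms, and for odd [n] each planar block contributes two more together
    with the last index.

    The last index in odd dimension is treated as half of a phantom block of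
    angle zero, whose second basis vector is the zero column; the terms with
    [1 - cos theta] are then the pair terms with [theta_k = 0]. *)

Set Implicit Arguments.
Unset Strict Implicit.
Unset Printing Implicit Defensive.

Import Order.TTheory GRing.Theory Num.Theory.
Import numFieldNormedType.Exports.

Local Open Scope classical_set_scope.
Local Open Scope ring_scope.

(** * Wedges of columns and the solution of A Z - Z A = A X *)

Definition wedge (R : comRingType) (n : nat) (x y : 'cV[R]_n) : 'M[R]_n :=
  x *m y^T - y *m x^T.

Lemma wedgeC (R : comRingType) (n : nat) (x y : 'cV[R]_n) :
  wedge y x = - wedge x y.
Proof. by rewrite /wedge opprB. Qed.

Lemma wedgeNl (R : comRingType) (n : nat) (x y : 'cV[R]_n) :
  wedge (- x) y = - wedge x y.
Proof. by rewrite /wedge linearN mulNmx mulmxN opprB opprK addrC. Qed.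

Lemma wedgeNr (R : comRingType) (n : nat) (x y : 'cV[R]_n) :
  wedge x (- y) = - wedge x y.
Proof. by rewrite wedgeC wedgeNl -wedgeC. Qed.

Lemma tr_wedge (R : comRingType) (n : nat) (x y : 'cV[R]_n) :
  (wedge x y)^T = - wedge x y.
Proof. by rewrite /wedge linearB /= !trmx_mul !trmxK opprB. Qed.

Lemma mul_outer (R : comRingType) (n : nat) (x y z t : 'cV[R]_n) (c : R) :
  y^T *m z = c%:M -> (x *m y^T) *m (z *m t^T) = c *: (x *m t^T).
Proof.
by move=> h; rewrite mulmxA -(mulmxA x) h mul_mx_scalar -scalemxAl.
Qed.

Lemma wedge_cube (R : comRingType) (n : nat) (u v : 'cV[R]_n) :
  u^T *m u = 1%:M -> v^T *m v = 1%:M -> u^T *m v = 0 ->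
  wedge u v *m wedge u v *m wedge u v = - wedge u v.
Proof.
move=> uu vv uv.
have vu : v^T *m u = 0 by rewrite -[u]trmxK -trmx_mul uv trmx0.
have uv0 : u^T *m v = 0%:M by rewrite uv raddf0.
have vu0 : v^T *m u = 0%:M by rewrite vu raddf0.
have sq : wedge u v *m wedge u v = - (u *m u^T) - v *m v^T.
  rewrite /wedge mulmxBl !mulmxBr.
  rewrite (mul_outer _ _ uu) (mul_outer _ _ vv) (mul_outer _ _ uv0) (mul_outer _ _ vu0).
  by rewrite !scale0r !scale1r !(sub0r, oppr0, addr0, subr0).
rewrite sq /wedge mulmxBl !mulmxBr !mulNmx.
rewrite (mul_outer _ _ uu) (mul_outer _ _ vv) (mul_outer _ _ uv0) (mul_outer _ _ vu0).
by rewrite !scale0r !scale1r !(sub0r, subr0, oppr0, addr0, opprK, opprB) addrC.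
Qed.

(** With [u' = J u] and [v' = J v] the quarter turns of [u] and [v] in their
    blocks, conjugation by [A] acts on the four-dimensional span of the wedges
    of [u, u'] with [v, v'], and [1 - Ad A^-1] has eigenvalues
    [1 - exp (+-i a +-i b)] there.  Its inverse is
    [1/2 - cot((a+b)/2)/2 J] on one eigenplane and the same with [a - b] on the
    other; adding the cotangents gives the coefficients [sin a / (cos b - cos a)]
    and [sin b / (cos b - cos a)] below. *)
Definition rotator (R : fieldType) (n : nat) (ca sa cb sb : R)
    (u u' v v' : 'cV[R]_n) : 'M[R]_n :=
  2^-1 *: (wedge u v - (sa / (cb - ca)) *: wedge u' v
           + (sb / (cb - ca)) *: wedge u v').

(** Tangency of the translate of [wedge u v] to the conjugacy class of a regular
    element.  The hypotheses on [A^T] are needed because [Z *m A] is expanded by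
    letting [A] act on the row factors. *)
Lemma rotator_eq (R : numFieldType) (n : nat) (A : 'M[R]_n) (ca sa cb sb : R)
    (u u' v v' : 'cV[R]_n) :
  A *m u = ca *: u + sa *: u' -> A *m u' = ca *: u' - sa *: u ->
  A *m v = cb *: v + sb *: v' -> A *m v' = cb *: v' - sb *: v ->
  A^T *m u = ca *: u - sa *: u' -> A^T *m u' = ca *: u' + sa *: u ->
  A^T *m v = cb *: v - sb *: v' -> A^T *m v' = cb *: v' + sb *: v ->
  ca ^+ 2 + sa ^+ 2 = 1 -> cb ^+ 2 + sb ^+ 2 = 1 -> cb - ca != 0 ->
  let Z := rotator ca sa cb sb u u' v v' in
  A *m Z - Z *m A = A *m wedge u v.
Proof.
move=> Au Au' Av Av' Tu Tu' Tv Tv' ha hb hD /=.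
have Tr x (y : 'cV[R]_n) : x *m y^T *m A = x *m (A^T *m y)^T.
  by rewrite trmx_mul trmxK mulmxA.
rewrite /rotator /wedge -!scalemxAr -!scalemxAl !(mulmxDr, mulmxDl) !(mulmxN, mulNmx)
  -!scalemxAr -!scalemxAl !(mulmxDr, mulmxDl) !(mulmxN, mulNmx).
rewrite !Tr !(mulmxA A) Au Au' Av Av' Tu Tu' Tv Tv'.
apply/matrixP => i j; rewrite !mxE !big_ord1 !mxE.
move: (u i 0) (u j 0) (u' i 0) (u' j 0) (v i 0) (v j 0) (v' i 0) (v' j 0).
move=> a a0 a' a0' b b0 b' b0'.
apply/eqP; rewrite -subr_eq0; apply/eqP.
(* The two sides differ by the discrepancy of the two Pythagorean identities. *)
transitivity ((2 * (cb - ca))^-1 * ((ca ^+ 2 + sa ^+ 2) - (cb ^+ 2 + sb ^+ 2))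
   * (a * b0 - b * a0)); last by rewrite ha hb; ring.
by field; rewrite hD.
Qed.

(** The wedge of [u'] and [u] generates the rotations of the block of [u], so the
    commutator is tangent to the torus.  Only the orthogonality relations enter:
    for the phantom block of the odd case [v' = 0]. *)
Lemma rotator_comm (R : numFieldType) (n : nat) (ca sa cb sb : R)
    (u u' v v' : 'cV[R]_n) :
  u^T *m u = 1%:M -> v^T *m v = 1%:M -> u^T *m v = 0 ->
  u'^T *m u = 0 -> u'^T *m v = 0 -> v'^T *m u = 0 -> v'^T *m v = 0 ->
  let Z := rotator ca sa cb sb u u' v v' in
  Z *m wedge u v - wedge u v *m Z =
    (sa / (2 * (cb - ca))) *: wedge u' u - (sb / (2 * (cb - ca))) *: wedge v' v.
Proof.
move=> uu vv uv u'u u'v v'u v'v /=.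
have s0 (x y : 'cV[R]_n) : x^T *m y = 0 -> x^T *m y = 0%:M /\ y^T *m x = 0%:M.
  by move=> h; rewrite h raddf0; split=> //; rewrite -[x]trmxK -trmx_mul h trmx0.
have [{}uv vu] := s0 _ _ uv. have [{}u'u uu'] := s0 _ _ u'u.
have [{}u'v vu'] := s0 _ _ u'v. have [{}v'u uv'] := s0 _ _ v'u.
have [{}v'v vv'] := s0 _ _ v'v.
have c1 : wedge u' v *m wedge u v = - (u' *m u^T).
  rewrite /wedge mulmxBl !mulmxBr.
  rewrite !(mul_outer _ _ vv, mul_outer _ _ vu, mul_outer _ _ u'u, mul_outer _ _ u'v).
  by rewrite !scale0r scale1r !(sub0r, subr0, oppr0, addr0, add0r).
have c2 : wedge u v *m wedge u' v = - (u *m u'^T).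
  rewrite /wedge mulmxBl !mulmxBr.
  rewrite !(mul_outer _ _ vv, mul_outer _ _ vu', mul_outer _ _ uu', mul_outer _ _ uv).
  by rewrite !scale0r scale1r !(sub0r, subr0, oppr0, addr0, add0r).
have c3 : wedge u v' *m wedge u v = - (v' *m v^T).
  rewrite /wedge mulmxBl !mulmxBr.
  rewrite !(mul_outer _ _ uu, mul_outer _ _ uv, mul_outer _ _ v'u, mul_outer _ _ v'v).
  by rewrite !scale0r scale1r !(sub0r, subr0, oppr0, addr0, add0r).
have c4 : wedge u v *m wedge u v' = - (v *m v'^T).
  rewrite /wedge mulmxBl !mulmxBr.
  rewrite !(mul_outer _ _ uu, mul_outer _ _ uv', mul_outer _ _ vu, mul_outer _ _ vv').
  by rewrite !scale0r scale1r !(sub0r, subr0, oppr0, addr0, add0r).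
rewrite /rotator; move: c1 c2 c3 c4.
move: (wedge u' v) (wedge u v') (wedge u v) => w1 w2 w0.
move=> c1 c2 c3 c4.
rewrite -scalemxAl -scalemxAr !(mulmxDl, mulmxDr, mulNmx, mulmxN) -!scalemxAl -!scalemxAr.
rewrite c1 c2 c3 c4 /wedge.
apply/matrixP => i j; rewrite !mxE !big_ord1 !mxE invfM.
ring.
Qed.

(** * Plane rotations and the exponential *)

(** Rodrigues' formula for the exponential of [s *: F]; it holds as soon as
    [F ^ 3 = - F]. *)
Definition plane_rot (R : realType) (n : nat) (F : 'M[R]_n) (s : R) : 'M[R]_n :=
  1%:M + sin s *: F + (1 - cos s) *: (F *m F).

Lemma plane_rot0 (R : realType) (n : nat) (F : 'M[R]_n) : plane_rot F 0 = 1%:M.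
Proof. by rewrite /plane_rot sin0 cos0 subrr !scale0r !addr0. Qed.

Lemma plane_rotD (R : realType) (n : nat) (F : 'M[R]_n) (s t : R) :
  F *m F *m F = - F -> plane_rot F s *m plane_rot F t = plane_rot F (s + t).
Proof.
move=> F3.
have FG : F *m (F *m F) = - F by rewrite mulmxA.
have GG : (F *m F) *m (F *m F) = - (F *m F) by rewrite -{1}mulmxA FG mulmxN.
rewrite /plane_rot !(mulmxDl, mulmxDr) !mul1mx !mulmx1 -!scalemxAl -!scalemxAr.
rewrite F3 FG GG sinD cosD; move: (F *m F) => G.
apply/matrixP => i j; rewrite !mxE; ring.
Qed.

Lemma tr_plane_rot (R : realType) (n : nat) (F : 'M[R]_n) (s : R) :
  F^T = - F -> (plane_rot F s)^T = plane_rot F (- s).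
Proof.
move=> FT; rewrite /plane_rot sinN cosN.
have GT : (F *m F)^T = F *m F by rewrite trmx_mul FT mulNmx mulmxN opprK.
move: GT; move: (F *m F) => G GT; apply/matrixP => i j.
move: FT GT => /matrixP/(_ i j) + /matrixP/(_ i j).
by rewrite !mxE => -> ->; rewrite eq_sym; ring.
Qed.

(** The determinant is one because the rotation is the square of the rotation by
    the half angle, which is orthogonal. *)
Lemma SO_plane_rot (R : realType) (n : nat) (F : 'M[R]_n) (s : R) :
  F *m F *m F = - F -> F^T = - F -> SO (plane_rot F s).
Proof.
move=> F3 FT; have PT r := tr_plane_rot r FT.
have PP r : plane_rot F r *m (plane_rot F r)^T = 1%:M.
  by rewrite PT plane_rotD // subrr plane_rot0.
split; first exact: PP.
  by rewrite PT plane_rotD // addNr plane_rot0.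
rewrite [s]splitr -plane_rotD // det_mulmx.
by have := congr1 determinant (PP (s / 2)); rewrite det_mulmx det_tr det1.
Qed.

Lemma cube_pow (R : realType) (n : nat) (F : 'M[R]_n) (k : nat) :
  F *m F *m F = - F ->
  F ^+ k.*2.+1 = (-1) ^+ k *: F /\ F ^+ k.*2.+2 = (-1) ^+ k *: (F *m F).
Proof.
move=> F3; have step m : (-1) ^+ m *: F *m F = (-1) ^+ m *: (F *m F).
  by rewrite -scalemxAl.
elim: k => [|k [IH1 IH2]]; first by rewrite expr1 expr2 !scale1r.
have odd_step : F ^+ k.+1.*2.+1 = (-1) ^+ k.+1 *: F.
  by rewrite doubleS exprSr IH2 -[_ * F]/(_ *m F) -scalemxAl F3 exprS mulN1r scaleNr scalerN.
split=> //; by rewrite exprSr odd_step -[_ * F]/(_ *m F) step.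
Qed.

(** Since [F ^ 3 = - F], the powers of [F] cycle through [F], [F ^ 2], [- F],
    [- F ^ 2]: the exponential series splits into the sine series times [F], minus
    the cosine series times [F ^ 2].  The term of index zero, which is the
    identity and not [- F ^ 2], accounts for the correction [1 + F ^ 2]. *)
Lemma expm_plane_rot (R : realType) (n : nat) (F : 'M[R]_n) (t : R) :
  F *m F *m F = - F -> expm (t *: F) = plane_rot F t.
Proof.
move=> F3.
have term (k : nat) : (k`!%:R : R)^-1 *: (t *: F) ^+ k =
    sin_coeff t k *: F - cos_coeff t k *: (F *m F)
    + (k == 0)%:R *: (1%:M + F *m F).
  have -> : (t *: F) ^+ k = t ^+ k *: F ^+ k.
    elim: k => [|k IH]; first by rewrite !expr0 scale1r.
    by rewrite !exprS IH -[LHS]/(_ *m _) -scalemxAl -scalemxAr scalerA.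
  rewrite scalerA /sin_coeff /cos_coeff /=.
  case: k => [|k].
    rewrite fact0 !expr0 expr0z invr1 !mul0r.
    by rewrite !mul1r scale0r !scale1r add0r -[1]/1%:M addrCA addNr addr0.
  rewrite scale0r addr0 -exprnP.
  have := odd_double_half k; case: (odd k) => /=; move: k./2 => m <-.
    rewrite add1n (cube_pow _ F3).2 /= !odd_double !doubleK /=.
    rewrite !mul0r scale0r sub0r mul1r scalerA -scaleNr [(-1) ^+ m.+1]exprS.
    congr (_ *: _).
    by move: (_`!%:R^-1) (t ^+ _) ((-1) ^+ m) => a b c; ring.
  rewrite add0n (cube_pow _ F3).1 /= !odd_double /= ?doubleK.
  rewrite !mul0r scale0r subr0 mul1r scalerA.
  congr (_ *: _).
  by move: (_`!%:R^-1) (t ^+ _) ((-1) ^+ m) => a b c; ring.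
rewrite /expm; apply: cvg_lim; first exact: norm_hausdorff.
rewrite (_ : series _ = fun N => series (sin_coeff t) N *: F
    - series (cos_coeff t) N *: (F *m F) + (0 < N)%:R *: (1%:M + F *m F)); last first.
  apply/funext => N; rewrite /series /=.
  under eq_bigr do rewrite term.
  rewrite big_split /= sumrB -!scaler_suml; congr (_ + _ *: _).
  case: N => [|N]; first by rewrite big_geq.
  by rewrite big_nat_recl // big1_eq addr0.
have -> : plane_rot F t = sin t *: F - cos t *: (F *m F) + 1 *: (1%:M + F *m F).
  by rewrite /plane_rot; move: (F *m F) => G; apply/matrixP=> i j; rewrite !mxE; ring.
apply: cvgD; first apply: cvgB.
- by apply: cvgZr_tmp; rewrite sin.unlock; apply: is_cvg_series_sin_coeff.
- by apply: cvgZr_tmp; rewrite cos.unlock; apply: is_cvg_series_cos_coeff.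
- apply: cvgZr_tmp; apply: cvg_near_cst; near=> N.
  by rewrite (_ : (0 < N)%N) //; near: N; exists 1%N.
Unshelve. all: by end_near. Qed.

(** * Derivatives of matrix curves *)

Lemma is_derive_mxP (R : realType) (m n : nat) (c : R -> 'M[R]_(m, n))
    (t : R) (v : 'M[R]_(m, n)) :
  is_derive t 1 c v <-> forall i j, is_derive t 1 (fun s => c s i j) (v i j).
Proof.
split=> [[dc <-] i j|dc].
  by apply: DeriveDef; [exact: (derivable_mxP _ _ _).1 | rewrite derive_mx // mxE].
have dM : derivable c t 1 by apply/derivable_mxP => i j; apply: ex_derive.
apply: DeriveDef => //; rewrite derive_mx //; apply/matrixP => i j.
by rewrite mxE; apply: derive_val.
Qed.

Lemma is_derive_mulmxr (R : realType) (m n p : nat) (c : R -> 'M[R]_(m, n))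
    (N : 'M[R]_(n, p)) (t : R) (v : 'M[R]_(m, n)) :
  is_derive t 1 c v -> is_derive t 1 (fun s => c s *m N) (v *m N).
Proof.
move=> /is_derive_mxP dc; apply/is_derive_mxP => i j; rewrite mxE.
rewrite (_ : (fun s => _) = \sum_k (fun s => c s i k * N k j)); last first.
  by apply/funext => s; rewrite mxE fct_sumE.
apply: is_derive_sum => k; have dk := dc i k.
by apply: is_derive_eq; rewrite /GRing.scale /= mulr0 add0r mulrC.
Qed.

Lemma is_derive_mulmxl (R : realType) (m n p : nat) (c : R -> 'M[R]_(n, p))
    (M : 'M[R]_(m, n)) (t : R) (v : 'M[R]_(n, p)) :
  is_derive t 1 c v -> is_derive t 1 (fun s => M *m c s) (M *m v).
Proof.
move=> /is_derive_mxP dc; apply/is_derive_mxP => i j; rewrite mxE.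
rewrite (_ : (fun s => _) = \sum_k (fun s => M i k * c s k j)); last first.
  by apply/funext => s; rewrite mxE fct_sumE.
by apply: is_derive_sum.
Qed.

Lemma derive_plane_rot (R : realType) (n : nat) (A F : 'M[R]_n) (t : R) :
  is_derive t 1 (fun s => A *m plane_rot F s)
    (A *m (cos t *: F + sin t *: (F *m F))).
Proof.
apply: is_derive_mulmxl; rewrite /plane_rot; move: (F *m F) => G.
apply/is_derive_mxP => i j.
rewrite (_ : (fun s => _) =
    (fun s => (1%:M : 'M[R]_n) i j + sin s * F i j + (1 - cos s) * G i j)).
  by rewrite !mxE; apply: is_derive_eq; rewrite /GRing.scale /=; ring.
by apply/funext => s; rewrite !mxE.
Qed.

Lemma derive_comp_curve (R : realType) (V : normedModType R) (g : V -> R)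
    (c : R -> V) (t : R) (v : V) :
  differentiable g (c t) -> is_derive t 1 c v ->
  is_derive t 1 (g \o c) ('d g (c t) v).
Proof.
move=> dg [dc cv].
have dc' : differentiable c t by apply/derivable1_diffP.
have dgc : differentiable (g \o c) t by apply: differentiable_comp.
apply: DeriveDef; first exact/derivable1_diffP.
by rewrite deriveE // diff_comp //= -(deriveE _ dc') cv.
Qed.

(** * Second derivatives of class functions *)

Lemma SO_mul (R : realType) (n : nat) (A B : 'M[R]_n) :
  SO A -> SO B -> SO (A *m B).
Proof.
case=> A1 A2 A3 [B1 B2 B3]; split.
- by rewrite trmx_mul mulmxA -(mulmxA A) B1 mulmx1.
- by rewrite trmx_mul mulmxA -(mulmxA B^T) A2 mulmx1.
- by rewrite det_mulmx A3 B3 mul1r.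
Qed.

Lemma SO_inv (R : realType) (n : nat) (A : 'M[R]_n) : SO A -> invmx A = A^T.
Proof.
case=> A1 A2 A3; have Au : A \in unitmx by rewrite unitmxE A3 unitr1.
by rewrite -[RHS]mulmx1 -(mulmxV Au) mulmxA A2 mul1mx.
Qed.

(** Conjugating [B *m A] by [A] exchanges the factors. *)
Lemma class_function_comm (R : realType) (n : nat) (f : 'M[R]_n -> R)
    (A B : 'M[R]_n) :
  class_function f -> SO A -> SO B -> f (A *m B) = f (B *m A).
Proof.
move=> fc SA SB; have [_ A2 _] := SA.
rewrite -[RHS](fc _ A) //; last exact: SO_mul.
by rewrite (SO_inv SA) -!mulmxA; case: SA => -> _ _; rewrite mulmx1.
Qed.

(** Infinitesimal conjugation invariance: differentiate
    [f (B e^(sF)) = f (e^(sF) B)] at [s = 0].  The curve on the right is rewritten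
    as [B e^(sF')] with [F' = B^T F B], so that both curves are left translates
    of a rotation. *)
Lemma diff_class_functionC (R : realType) (n : nat) (f g : 'M[R]_n -> R)
    (U : set 'M[R]_n) (B F : 'M[R]_n) :
  open U -> (forall B, U B -> SO B -> f B = g B) -> class_function f ->
  differentiable g B -> U B -> SO B ->
  F *m F *m F = - F -> F^T = - F ->
  'd g B (B *m F) = 'd g B (F *m B).
Proof.
move=> oU fg fc dg UB SB F3 FT; have [B1 B2 _] := SB.
pose F' := B^T *m F *m B.
have F'2 : F' *m F' = B^T *m (F *m F) *m B.
  by rewrite /F' !mulmxA -(mulmxA _ B) B1 mulmx1.
have F'3 : F' *m F' *m F' = - F'.
  by rewrite F'2 /F' !mulmxA -(mulmxA _ B) B1 mulmx1 -2!(mulmxA B^T) F3 mulmxN mulNmx.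
have F'T : F'^T = - F' by rewrite /F' !trmx_mul trmxK FT mulNmx mulmxN mulmxA.
have rotF' s : B *m plane_rot F' s = plane_rot F s *m B.
  rewrite /plane_rot F'2 /F' !mulmxDr !mulmxDl mulmx1 mul1mx -!scalemxAr -!scalemxAl.
  by rewrite !mulmxA B1 mul1mx.
have dcurve (G : 'M[R]_n) :
    is_derive (0:R) (1:R) (g \o (fun s => B *m plane_rot G s)) ('d g B (B *m G)).
  have c0 : B *m plane_rot G 0 = B by rewrite plane_rot0 mulmx1.
  have := derive_plane_rot B G 0; rewrite cos0 sin0 scale1r scale0r addr0 => dc.
  have := @derive_comp_curve R _ g _ 0 _ _ dc; rewrite c0; exact.
have nearU (G : 'M[R]_n) : \forall s \near (0:R), U (B *m plane_rot G s).
  have [dc _] := derive_plane_rot B G 0.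
  have cc : {for (0:R), continuous (fun s => B *m plane_rot G s)}.
    exact/differentiable_continuous/derivable1_diffP.
  apply: cc; rewrite plane_rot0 mulmx1; exact: open_nbhs_nbhs.
rewrite -[in RHS](mul1mx F) -B1 -!mulmxA (mulmxA B^T) -/F'.
rewrite -(@derive_val _ _ _ _ _ _ _ (dcurve F)) -(@derive_val _ _ _ _ _ _ _ (dcurve F')).
apply: near_eq_derive; near=> s; rewrite /= -!fg.
- by rewrite rotF' (class_function_comm fc) //; exact: SO_plane_rot.
- by near: s; exact: nearU.
- by apply: SO_mul => //; exact: SO_plane_rot.
- by near: s; exact: nearU.
- by apply: SO_mul => //; exact: SO_plane_rot.
Unshelve. all: by end_near. Qed.

Lemma diff_delta_sum (R : realType) (m n : nat) (g : 'M[R]_(m, n) -> R) (B W : 'M[R]_(m, n)) :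
  differentiable g B ->
  'd g B W = \sum_i \sum_j W i j * 'D_(delta_mx i j) g B.
Proof.
move=> dg; rewrite {1}[W]matrix_sum_delta linear_sum; apply: eq_bigr => i _.
by rewrite linear_sum; apply: eq_bigr => j _; rewrite linearZ /= deriveE.
Qed.

(** The heart of the computation.  Subtracting the tangential direction
    [c Z - Z c], on which the differential vanishes, makes the velocity
    [W = c X - (c Z - Z c)] vanish at [t = 0].  In the product rule for
    [t |-> Dg(c t)[W t]] only the derivative of [W] survives, and
    [W'(0) = A X X - A X Z + Z A X], where [Z A = A Z - A X]. *)
Lemma second_derivative_class_function (R : realType) (n : nat)
    (f g : 'M[R]_n -> R) (U : set 'M[R]_n) (A X Z : 'M[R]_n) :
  open U -> U A -> smooth_on U g -> (forall B, U B -> SO B -> f B = g B) ->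
  SO A -> X *m X *m X = - X -> X^T = - X ->
  (forall B, U B -> SO B -> 'd g B (B *m Z - Z *m B) = 0) ->
  A *m Z - Z *m A = A *m X ->
  derive1n 2 (fun t : R => f (A *m expm (t *: X))) 0
    = 'd g A (A *m (Z *m X - X *m Z)).
Proof.
move=> oU UA gU fg SA X3 XT dZ AZ.
have [dg dDg] : (forall B, U B -> differentiable g B) /\
    forall v B, U B -> differentiable (fun x => 'D_v g x) B.
  by have [dg Dg] := gU 2%N; split=> // v; have [] := Dg v.
pose c (t : R) : 'M[R]_n := A *m plane_rot X t.
have c0 : c 0 = A by rewrite /c plane_rot0 mulmx1.
have dc (t : R) : is_derive t (1 : R) c (c t *m X).
  apply: is_derive_eq; first exact: derive_plane_rot.
  rewrite /c -mulmxA; congr (_ *m _).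
  rewrite /plane_rot !mulmxDl mul1mx -!scalemxAl X3; move: (X *m X) => G.
  by apply/matrixP => i j; rewrite !mxE; ring.
have SOc t : SO (c t) by apply: SO_mul => //; exact: SO_plane_rot.
have cc : continuous c.
  move=> t; apply/differentiable_continuous/derivable1_diffP.
  exact: @ex_derive _ _ _ _ _ _ _ (dc t).
have oV : open (c @^-1` U) by apply: open_comp => // t _; exact: cc.
pose h := fun t : R => f (A *m expm (t *: X)).
pose W t := c t *m X - (c t *m Z - Z *m c t).
have dh t : U (c t) -> derive1 h t =
    \sum_i \sum_j W t i j * 'D_(delta_mx i j) g (c t).
  move=> Ut; rewrite -diff_delta_sum; last exact: dg.
  rewrite derive1E linearB /= dZ // subr0.
  have hc : \forall s \near t, h s = (g \o c) s.
    near=> s; rewrite /h (expm_plane_rot _ X3) -/(c s) fg //.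
    by near: s; apply: open_nbhs_nbhs.
  rewrite (near_eq_derive _ hc).
  by apply: derive_val; apply: derive_comp_curve => //; exact: dg.
rewrite -/h derive1nS derive1n1 derive1E.
rewrite (near_eq_derive _ (_ : \forall t \near 0, derive1 h t =
   \sum_i \sum_j W t i j * 'D_(delta_mx i j) g (c t))); last first.
  near=> t; apply: dh; near: t; apply: open_nbhs_nbhs; split=> //=; by rewrite c0.
rewrite diff_delta_sum; last exact: dg.
have dW : is_derive (0:R) 1 W (A *m (Z *m X - X *m Z)).
  have d0 := dc 0; rewrite c0 in d0.
  apply: is_derive_eq.
    by apply: is_deriveB; [|apply: is_deriveB];
      [exact: is_derive_mulmxr|exact: is_derive_mulmxr|exact: is_derive_mulmxl].
  have ZA : Z *m A = A *m Z - A *m X by rewrite -AZ subKr.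
  rewrite [Z *m (A *m X)]mulmxA ZA mulmxBl mulmxBr !mulmxA.
  by rewrite opprB addrA [_ + (_ - _)]addrC subrK.
have W0 : W 0 = 0 by rewrite /W c0 AZ subrr.
apply: derive_val.
rewrite [X in is_derive _ _ X _](_ : _ =
   \sum_i \sum_j ((fun t => W t i j) * (fun t => 'D_(delta_mx i j) g (c t)))); last first.
  apply/funext => t; rewrite fct_sumE; apply: eq_bigr => i _.
  by rewrite fct_sumE; apply: eq_bigr => j _.
apply: is_derive_sum => i; apply: is_derive_sum => j.
have dWij := (is_derive_mxP _ _ _).1 dW i j.
have Uc0 : U (c 0) by rewrite c0.
have dD := derive_comp_curve (dDg (delta_mx i j) _ Uc0) (dc 0).
apply: (is_derive_eq (is_deriveM dWij dD)).
by rewrite /= c0 W0 [X in X *: _]mxE scale0r add0r /GRing.scale /= mulrC.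
Unshelve. all: by end_near. Qed.

(** * The maximal torus *)

Definition ecol (R : realType) (n m : nat) : 'cV[R]_n :=
  \col_i (i == m :> nat)%:R.

(** The image of the basis column [m] under the quarter turn of its block.  Columns
    are indexed by all naturals, with value zero beyond the dimension: for
    [n = p.*2.+1] the column [p.*2] then has quarter turn zero, as befits a
    fixed axis. *)
Definition ecol' (R : realType) (n m : nat) : 'cV[R]_n :=
  if odd m then - ecol R n m.-1 else ecol R n m.+1.

(** Extension by zero to all block numbers, so that the final one-dimensional
    block of the odd case has angle zero. *)
Definition pad0 (R : realType) (p : nat) (a : 'I_p -> R) (k : nat) : R :=
  \sum_(l < p | l == k :> nat) a l.

Lemma pad0_ord (R : realType) (p : nat) (a : 'I_p -> R) (k : 'I_p) :
  pad0 a k = a k.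
Proof. by rewrite /pad0 (eq_bigl (pred1 k)) ?big_pred1_eq. Qed.

Lemma pad0_ge (R : realType) (p : nat) (a : 'I_p -> R) (k : nat) :
  (p <= k)%N -> pad0 a k = 0.
Proof. by move=> pk; apply: big1 => l; have := ltn_ord l; lia. Qed.

Lemma ecol_ge (R : realType) (n m : nat) : (n <= m)%N -> ecol R n m = 0.
Proof.
move=> nm; apply/matrixP => i j; rewrite !mxE.
by rewrite (_ : (_ == _) = false) //; have := ltn_ord i; lia.
Qed.

Lemma ecol_dot (R : realType) (n a b : nat) :
  (ecol R n a)^T *m ecol R n b = ((a == b) && (a < n)%N)%:R%:M.
Proof.
apply/matrixP => i j; rewrite !mxE !ord1 eqxx mulr1n.
have [an|na] := ltnP a n.
  rewrite (bigD1 (Ordinal an)) //= !mxE eqxx mul1r big1 ?addr0 ?andbT // => k.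
  by rewrite -val_eqE /= !mxE => /negbTE ->; rewrite mul0r.
rewrite andbF big1 // => k _; rewrite ecol_ge //.
by rewrite !mxE mul0r.
Qed.

Lemma ecol'_dot (R : realType) (n a b : nat) :
  a./2 != b./2 \/ a = b -> (ecol' R n a)^T *m ecol R n b = 0.
Proof.
move=> ab; rewrite /ecol'; case: ifP => oa.
  rewrite linearN /= mulNmx ecol_dot (_ : (_ == _) = false) ?raddf0 ?oppr0 //.
  by case: ab => [|<-]; lia.
rewrite ecol_dot (_ : (_ == _) = false) ?raddf0 //.
by case: ab => [|<-]; lia.
Qed.

(** For [n = p.*2.+1] the final entry 1 is the entry of a rotation by the padded
    angle zero, which removes the odd case as a special case. *)
Lemma torus_mxE (R : realType) (n p : nat) (Theta : 'rV[R]_p) (i j : 'I_n) :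
  (n <= p.*2.+1)%N ->
  torus_mx n Theta i j = if i./2 == j./2
    then rot2 (pad0 (Theta 0) i./2) (odd i) (odd j) else 0.
Proof.
move=> np; rewrite mxE; have := ltn_ord i; have := ltn_ord j => jn lin.
have [ij|ij] := eqVneq i./2 j./2; last first.
  rewrite big1 ?add0r => [|k]; last by lia.
  by rewrite (_ : (_ == _) = false) //; apply/negbTE; apply: contraNneq ij => ->.
have [ip|pi] := ltnP i./2 p.
  rewrite (_ : _ && _ = false) ?addr0; last by lia.
  rewrite (big_pred1 (Ordinal ip)) => [|k]; last by rewrite /= -[k == _]val_eqE /=; lia.
  by rewrite (pad0_ord (Theta 0) (Ordinal ip)).
rewrite pad0_ge // big1 ?add0r => [|k]; last by have := ltn_ord k; lia.
have -> : i = j by apply/val_inj => /=; lia.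
by rewrite /rot2 !eqxx cos0 (_ : (_ == _) = true) //; lia.
Qed.

Lemma torus_ecol (R : realType) (n p : nat) (Theta : 'rV[R]_p) (m : nat) :
  (p.*2 <= n <= p.*2.+1)%N ->
  torus_mx n Theta *m ecol R n m =
    cos (pad0 (Theta 0) m./2) *: ecol R n m
    + sin (pad0 (Theta 0) m./2) *: ecol' R n m.
Proof.
move=> /andP[pn np]; have [mn|nm] := ltnP m n; last first.
  rewrite pad0_ge; last by lia.
  by rewrite ecol_ge // mulmx0 sin0 scaler0 scale0r addr0.
apply/matrixP => i j; rewrite [LHS]mxE (bigD1 (Ordinal mn)) //= big1 ?addr0; last first.
  move=> k; rewrite -val_eqE /= [X in _ * X]mxE => /negbTE ->.
  by rewrite mulr0.
rewrite torus_mxE // /ecol' /rot2 [X in _ * X]mxE eqxx mulr1 /=.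
rewrite [RHS]mxE ![in RHS]mxE.
have [im|im] := eqVneq i./2 m./2; last first.
  rewrite (_ : (_ == _) = false) ?mulr0 ?add0r; last by lia.
  case: ifP => om; rewrite !mxE (_ : (_ == _) = false) ?oppr0 ?mulr0 //; lia.
rewrite im; have [oim|oim] := eqVneq (odd i) (odd m).
  rewrite (_ : (_ == _) = true) ?mulr1; last by lia.
  case: ifP => om; rewrite !mxE (_ : (_ == _) = false) ?oppr0 ?mulr0 ?addr0 //; lia.
rewrite (_ : (_ == _) = false) ?mulr0 ?add0r; last by lia.
case: ifP oim => om oim; rewrite !mxE (_ : (_ == _) = true) ?mulrN ?mulr1 //; lia.
Qed.

Lemma torus_ecol' (R : realType) (n p : nat) (Theta : 'rV[R]_p) (m : nat) :
  (p.*2 <= n <= p.*2.+1)%N ->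
  torus_mx n Theta *m ecol' R n m =
    cos (pad0 (Theta 0) m./2) *: ecol' R n m
    - sin (pad0 (Theta 0) m./2) *: ecol R n m.
Proof.
move=> np; rewrite {1 2}/ecol'; case: ifP => om.
  rewrite mulmxN torus_ecol // (_ : m.-1./2 = m./2); last by lia.
  rewrite /ecol' (_ : odd m.-1 = false); last by lia.
  by rewrite prednK ?odd_gt0 // scalerN opprD.
rewrite torus_ecol // (_ : m.+1./2 = m./2); last by lia.
by rewrite /ecol' /= om /= scalerN.
Qed.

(** Reduces identities between torus matrices to trigonometry on each column. *)
Lemma ecol_eq_mx (R : realType) (n : nat) (A B : 'M[R]_n) :
  (forall m, A *m ecol R n m = B *m ecol R n m) -> A = B.
Proof.
have E (C : 'M[R]_n) i j : (C *m ecol R n (nat_of_ord j)) i 0 = C i j.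
  rewrite mxE (bigD1 j) //= big1 ?addr0 => [|k]; rewrite mxE ?eqxx ?mulr1 //.
  by rewrite -val_eqE => /negbTE ->; rewrite mulr0.
by move=> h; apply/matrixP => i j; rewrite -!E h.
Qed.

Lemma torus_mxD (R : realType) (n p : nat) (T1 T2 : 'rV[R]_p) :
  (p.*2 <= n <= p.*2.+1)%N ->
  torus_mx n T1 *m torus_mx n T2 = torus_mx n (T1 + T2).
Proof.
move=> np; apply: ecol_eq_mx => m.
have pad0D : pad0 ((T1 + T2) 0) m./2 = pad0 (T1 0) m./2 + pad0 (T2 0) m./2.
  by rewrite /pad0 -big_split; apply: eq_bigr => l _; rewrite mxE.
rewrite -mulmxA !torus_ecol // mulmxDr -!scalemxAr torus_ecol // torus_ecol' //.
rewrite pad0D sinD cosD.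
by apply/matrixP => i j; rewrite !mxE; ring.
Qed.

Lemma torus_mx0 (R : realType) (n p : nat) :
  (p.*2 <= n <= p.*2.+1)%N -> torus_mx n (0 : 'rV[R]_p) = 1%:M.
Proof.
move=> np; apply: ecol_eq_mx => m; rewrite torus_ecol // mul1mx.
rewrite /pad0 big1 => [|l _]; last by rewrite mxE.
by rewrite sin0 cos0 scale1r scale0r addr0.
Qed.

Lemma tr_torus_mx (R : realType) (n p : nat) (Theta : 'rV[R]_p) :
  (torus_mx n Theta)^T = torus_mx n (- Theta).
Proof.
apply/matrixP => i j; rewrite !mxE eq_sym; congr (_ + _); last first.
  by case: eqVneq => // ->.
apply: eq_big => [k|k _]; first by rewrite andbC.
by rewrite mxE /rot2 sinN cosN eq_sym opprK; case: (odd i) (odd j) => [] [].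
Qed.

(** As for plane rotations, the determinant is the square of that of the
    half-angle element. *)
Lemma SO_torus (R : realType) (n p : nat) (Theta : 'rV[R]_p) :
  (p.*2 <= n <= p.*2.+1)%N -> SO (torus_mx n Theta).
Proof.
move=> np.
have TT (T : 'rV[R]_p) : torus_mx n T *m (torus_mx n T)^T = 1%:M :> 'M[R]_n.
  by rewrite tr_torus_mx torus_mxD // subrr torus_mx0.
split; first exact: TT.
  by rewrite tr_torus_mx torus_mxD // addNr torus_mx0.
have -> : Theta = 2^-1 *: Theta + 2^-1 *: Theta.
  by rewrite -scalerDl (_ : _ + _ = 1) ?scale1r //; lra.
rewrite -torus_mxD // det_mulmx.
by have := congr1 determinant (TT (2^-1 *: Theta)); rewrite det_mulmx det_tr det1.
Qed.

Definition torus_gen (R : realType) (n k : nat) : 'M[R]_n :=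
  wedge (ecol R n k.*2.+1) (ecol R n k.*2).

(** Both columns of a block give the same oriented generator: the sign in the
    quarter turn of the odd column compensates the exchange of the factors. *)
Lemma wedge_ecol'_ecol (R : realType) (n m : nat) :
  wedge (ecol' R n m) (ecol R n m) = torus_gen R n m./2.
Proof.
rewrite /torus_gen /ecol'; case: ifP => om.
  by rewrite wedgeNl -wedgeC; congr wedge; congr ecol; lia.
by congr wedge; congr ecol; lia.
Qed.

Lemma wedge_ecol_cube (R : realType) (n a b : nat) :
  a != b -> let F := wedge (ecol R n a) (ecol R n b) in F *m F *m F = - F.
Proof.
move=> ab /=; have [an|na] := ltnP a n; last first.
  by rewrite /wedge (ecol_ge _ na) trmx0 mul0mx mulmx0 subrr !mul0mx oppr0.
have [bn|nb] := ltnP b n; last first.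
  by rewrite /wedge (ecol_ge _ nb) trmx0 mul0mx mulmx0 subrr !mul0mx oppr0.
apply: wedge_cube; rewrite ecol_dot ?eqxx ?an ?bn //.
by rewrite (negbTE ab) raddf0.
Qed.

Lemma torus_gen_ecol (R : realType) (n k m : nat) : (k.*2.+1 < n)%N ->
  torus_gen R n k *m ecol R n m = (m./2 == k)%:R *: ecol' R n m.
Proof.
move=> kn; rewrite /torus_gen /wedge mulmxBl -!mulmxA !ecol_dot kn (ltnW kn) !andbT.
rewrite !mul_mx_scalar /ecol'; case: ifP => om.
  rewrite (_ : (k.*2 == m) = false) ?scale0r ?sub0r; last by lia.
  rewrite (_ : (k.*2.+1 == m) = (m./2 == k)); last by lia.
  case: eqVneq => [<-|]; last by rewrite !scale0r oppr0.
  by rewrite !scale1r; congr (- ecol _ _ _); lia.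
rewrite (_ : (k.*2.+1 == m) = false) ?scale0r ?subr0; last by lia.
rewrite (_ : (k.*2 == m) = (m./2 == k)); last by lia.
case: eqVneq => [<-|]; last by rewrite !scale0r.
by rewrite !scale1r; congr (ecol _ _ _); lia.
Qed.

Lemma torus_gen_ecol' (R : realType) (n k m : nat) : (k.*2.+1 < n)%N ->
  torus_gen R n k *m ecol' R n m = - ((m./2 == k)%:R *: ecol R n m).
Proof.
move=> kn; rewrite {1}/ecol'; case: ifP => om.
  rewrite mulmxN torus_gen_ecol // (_ : m.-1./2 = m./2); last by lia.
  rewrite /ecol' (_ : odd m.-1 = false); last by lia.
  by rewrite prednK ?odd_gt0.
rewrite torus_gen_ecol // (_ : m.+1./2 = m./2); last by lia.
by rewrite /ecol' /= om /= scalerN.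
Qed.

Lemma torus_mx_shift (R : realType) (n p : nat) (Theta : 'rV[R]_p) (k : 'I_p) (t : R) :
  (p.*2 <= n <= p.*2.+1)%N ->
  torus_mx n (Theta + t *: delta_mx 0 k) =
    torus_mx n Theta *m plane_rot (torus_gen R n k) t.
Proof.
move=> np; rewrite -torus_mxD //; congr (_ *m _); apply: ecol_eq_mx => m.
have kn : (k.*2.+1 < n)%N by have := ltn_ord k; lia.
move: (torus_gen_ecol R m kn) (torus_gen_ecol' R m kn).
rewrite torus_ecol // /plane_rot; move: (torus_gen R n k) => G Ge Ge'.
rewrite !mulmxDl mul1mx -!scalemxAl -mulmxA Ge -scalemxAr Ge'.
have -> : pad0 ((t *: delta_mx 0 k : 'rV[R]_p) 0) m./2 = (m./2 == k)%:R * t.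
  case: eqVneq => [->|mk]; first by rewrite pad0_ord !mxE !eqxx mulr1 mul1r.
  rewrite /pad0 big1 ?mul0r // => l /eqP lm.
  by rewrite !mxE eqxx -val_eqE /= lm (negbTE mk) mulr0.
case: eqVneq => _; rewrite ?mul1r ?mul0r /= ?mulr1n ?mulr0n.
  by rewrite !scale1r; apply/matrixP => i j; rewrite !mxE; ring.
by rewrite sin0 cos0; apply/matrixP => i j; rewrite !mxE; ring.
Qed.

(** * The terms of the Laplacian on the torus *)

Lemma derive1_line (R : realType) (V : normedModType R) (phi : V -> R)
    (x v : V) (t : R) :
  derive1 (fun s : R => phi (x + s *: v)) t = 'D_v phi (x + t *: v).
Proof.
rewrite derive1E /derive.
rewrite [X in lim (X @ _) = _](_ : _ =
    fun h => h^-1 *: ((phi \o shift (x + t *: v)) (h *: v) - phi (x + t *: v))) //.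
by apply/funext => s /=; rewrite [s *: 1]mulr1 scalerDl addrCA.
Qed.

(** The basis vector is minus the generator of the block, so the curve is the torus
    line [Theta - t e_k]; the two signs cancel in the second derivative. *)
Lemma laplacian_same_block (R : realType) (n p : nat) (f : 'M[R]_n -> R)
    (Theta : 'rV[R]_p) (k : 'I_p) :
  (p.*2 <= n <= p.*2.+1)%N -> smooth_on setT (restr_torus f : 'rV[R]_p -> R) ->
  derive1n 2 (fun t : R => f (torus_mx n Theta
     *m expm (t *: wedge (ecol R n k.*2) (ecol R n k.*2.+1)))) 0
  = pd k (pd k (restr_torus f)) Theta.
Proof.
move=> np sphi; set phi := restr_torus f; set d : 'rV[R]_p := delta_mx 0 k.
have [dphi Dphi] := sphi 2%N.
have dN psi x : differentiable psi x -> 'D_(- d) psi x = - 'D_d psi x :> R.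
  by move=> dpsi; rewrite !deriveE // linearN.
rewrite (_ : (fun t => _) = fun t => phi (Theta + t *: - d)); last first.
  apply/funext => t; rewrite wedgeC scalerN -scaleNr expm_plane_rot; last first.
    by apply: wedge_ecol_cube; lia.
  by rewrite -torus_mx_shift // scaleNr scalerN.
rewrite derive1nS derive1n1.
have -> : derive1 (fun t => phi (Theta + t *: - d)) =
    fun t => (- pd k phi) (Theta + t *: - d).
  by apply/funext => t; rewrite derive1_line dN //; exact: dphi.
rewrite derive1_line scale0r addr0.
have dpd : differentiable (pd k phi) Theta by have [h _] := Dphi d; exact: h Theta I.
rewrite dN; last exact: differentiableN.
rewrite deriveN ?opprK //; exact: diff_derivable.
Qed.

(** Translates the differential of the extension [g] along the torus into partial
    derivatives of the restriction.  At the final index of the odd case both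
    sides vanish: the quarter turn is zero and so is the padded value. *)
Lemma diff_torus_gen (R : realType) (n p : nat) (f g : 'M[R]_n -> R)
    (U : set 'M[R]_n) (Theta : 'rV[R]_p) (m : nat) :
  (p.*2 <= n <= p.*2.+1)%N -> let A := torus_mx n Theta in
  open U -> U A -> differentiable g A ->
  (forall B, U B -> SO B -> f B = g B) -> (m < n)%N ->
  'd g A (A *m wedge (ecol' R n m) (ecol R n m)) =
    pad0 (fun k => pd k (restr_torus f) Theta) m./2.
Proof.
move=> np A oU UA dg fg mn; have [mp|pm] := ltnP m./2 p; last first.
  rewrite pad0_ge // /ecol' (_ : odd m = false); last by lia.
  by rewrite ecol_ge ?/wedge ?trmx0 ?mul0mx ?mulmx0 ?subrr ?mulmx0 ?linear0 //; lia.
rewrite (pad0_ord _ (Ordinal mp)) wedge_ecol'_ecol.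
pose k := Ordinal mp; pose G := torus_gen R n m./2.
rewrite /pd -[X in _ = 'D_ _ _ X]addr0 -(scale0r (delta_mx 0 k)) -derive1_line derive1E.
have c0 : A *m plane_rot G 0 = A by rewrite plane_rot0 mulmx1.
have dc := derive_plane_rot A G 0.
have {}dc : is_derive (0:R) (1:R) (fun s => A *m plane_rot G s) (A *m G).
  by apply: (is_derive_eq dc); rewrite cos0 sin0 scale1r scale0r addr0.
have := @derive_comp_curve R _ g _ 0 _ _ dc; rewrite c0 => /(_ dg) dgc.
rewrite -(@derive_val _ _ _ _ _ _ _ dgc).
apply: near_eq_derive; near=> s.
rewrite /restr_torus (torus_mx_shift _ _ _ np) /= fg //.
- near: s; have cc : {for (0:R), continuous (fun s => A *m plane_rot G s)}.
    by apply/differentiable_continuous/derivable1_diffP; apply: ex_derive.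
  by apply: cc; rewrite c0; exact: open_nbhs_nbhs.
- apply: SO_mul; first exact: SO_torus.
  apply: SO_plane_rot; first by apply: wedge_ecol_cube; lia.
  exact: tr_wedge.
Unshelve. all: by end_near. Qed.

Lemma so_basis_wedge (R : realType) (n : nat) (i j : 'I_n) :
  so_basis R i j = wedge (ecol R n i) (ecol R n j).
Proof.
apply/matrixP => a b; rewrite /so_basis /wedge !mxE !big_ord1 !mxE.
by rewrite -!val_eqE /= -!natrM !mulnb.
Qed.

(** The vector [Z] of [rotator] is a combination of wedges of basis columns, hence
    a tangential direction; [rotator_comm] and [diff_torus_gen] then evaluate
    [Dg(A)[A (Z X - X Z)]]. *)
Lemma laplacian_cross_block (R : realType) (n p : nat) (f : 'M[R]_n -> R)
    (Theta : 'rV[R]_p) (i j : 'I_n) :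
  (p.*2 <= n <= p.*2.+1)%N -> smooth_on_SO f -> class_function f ->
  i./2 != j./2 ->
  let theta k := pad0 (Theta 0) k in
  let dphi := pad0 (fun k => pd k (restr_torus f) Theta) in
  cos (theta j./2) - cos (theta i./2) != 0 ->
  derive1n 2 (fun t : R => f (torus_mx n Theta *m expm (t *: so_basis R i j))) 0
  = (sin (theta i./2) * dphi i./2 - sin (theta j./2) * dphi j./2)
    / (2 * (cos (theta j./2) - cos (theta i./2))).
Proof.
move=> np sf cf ij theta dphi hD; set A := torus_mx n Theta.
have SA : SO A := SO_torus Theta np.
have [U [g [oU UA gU fg]]] := sf A SA.
have [dg _] := gU 1%N.
rewrite so_basis_wedge; set u := ecol R n i; set v := ecol R n j.
set u' := ecol' R n i; set v' := ecol' R n j.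
pose ca := cos (theta i./2); pose sa := sin (theta i./2).
pose cb := cos (theta j./2); pose sb := sin (theta j./2).
have pad0N k : pad0 ((- Theta) 0) k = - theta k.
  by rewrite /pad0 -sumrN; apply: eq_bigr => l _; rewrite mxE.
have iNj : nat_of_ord i != j by apply: contraNneq ij => ->.
have dwedge a b B : a != b -> U B -> SO B ->
    'd g B (B *m wedge (ecol R n a) (ecol R n b)
            - wedge (ecol R n a) (ecol R n b) *m B) = 0.
  move=> ab UB SB; rewrite linearB /= (diff_class_functionC oU fg cf (dg _ UB) UB SB) ?subrr //.
    exact: wedge_ecol_cube.
  exact: tr_wedge.
have dwedgeu' B : U B -> SO B -> 'd g B (B *m wedge u' v - wedge u' v *m B) = 0.
  move=> UB SB; rewrite /u' /ecol'; case: ifP => oi; last by apply: dwedge => //; lia.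
  by rewrite wedgeNl mulmxN mulNmx -opprD linearN dwedge ?oppr0 //; lia.
have dwedgev' B : U B -> SO B -> 'd g B (B *m wedge u v' - wedge u v' *m B) = 0.
  move=> UB SB; rewrite /v' /ecol'; case: ifP => oj; last by apply: dwedge => //; lia.
  by rewrite wedgeNr mulmxN mulNmx -opprD linearN dwedge ?oppr0 //; lia.
pose Z := rotator ca sa cb sb u u' v v'.
have dZ B : U B -> SO B -> 'd g B (B *m Z - Z *m B) = 0.
  move=> UB SB; have := dwedgeu' B UB SB; have := dwedgev' B UB SB.
  have := dwedge i j B iNj UB SB; rewrite /Z /rotator -/u -/v.
  move: (wedge u v) (wedge u' v) (wedge u v') => w0 w1 w2 h0 h1 h2.
  have -> : forall a b c : R, B *m (a *: (w0 - b *: w1 + c *: w2))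
        - a *: (w0 - b *: w1 + c *: w2) *m B
      = a *: ((B *m w0 - w0 *m B) - b *: (B *m w1 - w1 *m B) + c *: (B *m w2 - w2 *m B)).
    move=> a b c; rewrite -scalemxAr -scalemxAl !mulmxDr !mulmxDl !mulmxN !mulNmx.
    rewrite -!scalemxAr -!scalemxAl.
    by apply/matrixP => x y; rewrite [in LHS]mxE !mxE; ring.
  rewrite linearZ linearD linearB !linearZ /= h0 h1 h2; lra.
have AZ : A *m Z - Z *m A = A *m wedge u v.
  apply: rotator_eq; rewrite /A ?tr_torus_mx ?torus_ecol ?torus_ecol' ?pad0N ?sinN ?cosN //.
  - by rewrite scaleNr.
  - by rewrite scaleNr opprK.
  - by rewrite scaleNr.
  - by rewrite scaleNr opprK.
  - exact: cos2Dsin2.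
  - exact: cos2Dsin2.
rewrite (second_derivative_class_function oU UA gU fg SA _ _ dZ AZ); last 2 first.
- exact: wedge_ecol_cube.
- exact: tr_wedge.
rewrite rotator_comm; first last.
- by apply: ecol'_dot; right.
- by apply: ecol'_dot; left; rewrite eq_sym.
- by apply: ecol'_dot; left.
- by apply: ecol'_dot; right.
- by rewrite ecol_dot (negbTE iNj) raddf0.
- by rewrite ecol_dot eqxx ltn_ord.
- by rewrite ecol_dot eqxx ltn_ord.
rewrite mulmxBr -!scalemxAr linearB !linearZ /=.
rewrite !(diff_torus_gen np oU UA (dg _ UA) fg) // /GRing.scale /= -/dphi -/ca -/cb -/sa -/sb.
ring.
Qed.

(** * Summation over the basis *)

Lemma sum_double (R : nmodType) (p : nat) (F : nat -> R) :
  \sum_(i < p.*2) F i = \sum_(k < p) (F k.*2 + F k.*2.+1).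
Proof.
elim: p => [|p IH]; first by rewrite !big_ord0.
by rewrite doubleS !big_ord_recr /= IH addrA.
Qed.

(** Among the four index pairs with halves [(k, l)], all four are increasing when
    [k < l], and exactly one, [(2k, 2k+1)], when [k = l]. *)
Lemma sum_pairs_half (R : pzRingType) (p : nat) (T : nat -> nat -> R) :
  \sum_(i < p.*2) \sum_(j < p.*2 | (i < j)%N) T i./2 j./2 =
  \sum_(k < p) T k k + \sum_(k < p) \sum_(l < p | (k < l)%N) T k l *+ 4.
Proof.
rewrite (sum_double p (fun i => \sum_(j < p.*2 | (i < j)%N) T i./2 j./2)) -big_split.
apply: eq_bigr => k _ /=; rewrite uphalf_double doubleK.
rewrite [\sum_(j < _ | _) _]big_mkcond [X in _ + X = _]big_mkcond.
rewrite (sum_double p (fun j => if (k.*2 < j)%N then T k j./2 else 0)).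
rewrite (sum_double p (fun j => if (k.*2.+1 < j)%N then T k j./2 else 0)).
rewrite -big_split [X in _ = _ + X]big_mkcond /=.
have -> : T k k = \sum_(l < p) if l == k then T k l else 0.
  by rewrite -big_mkcond big_pred1_eq.
rewrite -big_split; apply: eq_bigr => l _ /=.
rewrite uphalf_double doubleK !ltnS ltn_double leq_double -val_eqE /=.
have -> : (k.*2.+1 < l.*2)%N = (k < l)%N by lia.
have [kl|lk|kl] := ltngtP k l.
- by rewrite add0r !mulrS mulr0n addr0 !addrA.
- by rewrite !addr0.
- by rewrite !addr0 add0r.
Qed.

Lemma sum_pairs_half_odd (R : pzRingType) (p : nat) (T : nat -> nat -> R) :
  \sum_(i < p.*2.+1) \sum_(j < p.*2.+1 | (i < j)%N) T i./2 j./2 =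
  \sum_(i < p.*2) \sum_(j < p.*2 | (i < j)%N) T i./2 j./2
  + \sum_(k < p) T k p *+ 2.
Proof.
rewrite big_ord_recr /= [X in _ + X]big1 ?addr0; last first.
  by move=> j; have := ltn_ord j; lia.
have -> : \sum_(k < p) T k p *+ 2 = \sum_(i < p.*2) T i./2 p.
  rewrite (sum_double p (fun i => T i./2 p)); apply: eq_bigr => k _.
  by rewrite /= uphalf_double doubleK mulr2n.
rewrite -big_split; apply: eq_bigr => i _ /=.
rewrite big_mkcond big_ord_recr /= ltn_ord doubleK; congr (_ + _).
by rewrite [RHS]big_mkcond.
Qed.

Definition radial_term (R : realType) (p : nat) (phi : 'rV[R]_p -> R)
    (Theta : 'rV[R]_p) (i j : nat) : R :=
  let theta := pad0 (Theta 0) in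
  let dphi := pad0 (fun k => pd k phi Theta) in
  if i == j then pad0 (fun k => pd k (pd k phi) Theta) i
  else (sin (theta i) * dphi i - sin (theta j) * dphi j)
         / (2 * (cos (theta j) - cos (theta i))).

Lemma laplacian_torus (R : realType) (n p : nat) (f : 'M[R]_n -> R)
    (Theta : 'rV[R]_p) :
  (p.*2 <= n <= p.*2.+1)%N -> smooth_on_SO f -> class_function f ->
  smooth_on setT (restr_torus f : 'rV[R]_p -> R) ->
  (forall i j : 'I_n, (i./2 < j./2)%N ->
     cos (pad0 (Theta 0) j./2) - cos (pad0 (Theta 0) i./2) != 0) ->
  laplacian f (torus_mx n Theta) =
    \sum_(i < n) \sum_(j < n | (i < j)%N)
      radial_term (restr_torus f) Theta i./2 j./2.
Proof.
move=> np sf cf sphi hD; apply: eq_bigr => i _; apply: eq_bigr => j ij.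
rewrite /radial_term; case: eqVneq => [ijh|ijh]; last first.
  by apply: laplacian_cross_block => //; apply: hD; lia.
have jn := ltn_ord j; have ip : (i./2 < p)%N by lia.
rewrite so_basis_wedge (pad0_ord _ (Ordinal ip)).
rewrite -(@laplacian_same_block _ _ _ f Theta (Ordinal ip) np sphi).
have -> : ecol R n i = ecol R n (Ordinal ip).*2 by congr ecol => /=; lia.
by have -> : ecol R n j = ecol R n (Ordinal ip).*2.+1 by congr ecol => /=; lia.
Qed.

Lemma sum_radial_term (R : realType) (p : nat) (phi : 'rV[R]_p -> R)
    (Theta : 'rV[R]_p) :
  (forall j k : 'I_p, (j < k)%N ->
     cos (Theta 0 k) - cos (Theta 0 j) != 0) ->
  \sum_(i < p.*2) \sum_(j < p.*2 | (i < j)%N) radial_term phi Theta i./2 j./2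
  = even_operator phi Theta.
Proof.
move=> hD; rewrite sum_pairs_half; congr (_ + _); apply: eq_bigr => k _.
  by rewrite /radial_term eqxx pad0_ord.
apply: eq_bigr => l kl.
rewrite /radial_term (_ : (_ == _) = false) ?pad0_ord; last by lia.
by field; exact: hD.
Qed.

Theorem theorem3p1 (R : realType) (p : nat) :
  ((2 <= p)%N ->
     forall phi Lphi : 'rV[R]_p -> R,
       smooth_torus p.*2 phi -> radial_laplacian p.*2 phi Lphi ->
       forall Theta : 'rV[R]_p,
         (forall j k : 'I_p, (j < k)%N ->
            cos (Theta 0 k) - cos (Theta 0 j) != 0) ->
         Lphi Theta = even_operator phi Theta)
  /\
  ((1 <= p)%N ->
     forall phi Lphi : 'rV[R]_p -> R,
       smooth_torus p.*2.+1 phi -> radial_laplacian p.*2.+1 phi Lphi ->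
       forall Theta : 'rV[R]_p,
         (forall j k : 'I_p, (j < k)%N ->
            cos (Theta 0 k) - cos (Theta 0 j) != 0) ->
         (forall j : 'I_p, 1 - cos (Theta 0 j) != 0) ->
         Lphi Theta = odd_operator phi Theta).
Proof.
split=> [_|_] phi Lphi [sphi _ _] [f [sf cf phiE ->]] Theta hD.
  rewrite phiE in sphi *; rewrite -sum_radial_term //.
  apply: laplacian_torus => // [|i j ij]; first by lia.
  have jn := ltn_ord j; have jp : (j./2 < p)%N by lia.
  have ip : (i./2 < p)%N by lia.
  rewrite (pad0_ord _ (Ordinal jp)) (pad0_ord _ (Ordinal ip)); exact: hD.
move=> hD1; rewrite phiE in sphi *.
rewrite [LHS](laplacian_torus _ sf cf sphi) => [||i j ij]; first last.
- have jn := ltn_ord j; have ip : (i./2 < p)%N by lia.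
  rewrite (pad0_ord _ (Ordinal ip)); have [jp|pj] := ltnP j./2 p.
    by rewrite (pad0_ord _ (Ordinal jp)); exact: hD.
  by rewrite pad0_ge // cos0; exact: hD1.
- by lia.
rewrite sum_pairs_half_odd sum_radial_term // /odd_operator /even_operator.
rewrite [X in _ = X + _]big_split /= [RHS]addrAC; congr (_ + _); apply: eq_bigr => k _.
rewrite /radial_term (_ : (_ == _) = false); last by have := ltn_ord k; lia.
rewrite !pad0_ord !pad0_ge // sin0 cos0.
by field; exact: hD1.
Qed.
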